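(* Let $\mathcal A=\{a+\alpha\epsilon: a,\alpha\in\mathbb R,\ \epsilon^2=0\}$ be the dual numbers with involution $\sigma(a+\alpha\epsilon)=a-\alpha\epsilon$. For integers $\alpha,\beta,\gamma$ with $\alpha+\beta+\gamma=0$, the triple $(1+\alpha\epsilon,\,1+\beta\epsilon,\,1+\gamma\epsilon)$ is an admissible starting triple (with $R=\{a+\alpha\epsilon: a,\alpha\in\mathbb Z\}$ and $P$ the positive real numbers).
   Context: The positive structure $P$ on $(\mathcal A,\sigma)$ is the set of positive real numbers in $\mathcal A^\sigma=\mathbb R$. For a triple $(a,b,c)$ of invertible elements, the noncommutative angles are the six elements $\sigma(a^{-1})b\sigma(c^{-1})$, $\sigma(b^{-1})c\sigma(a^{-1})$, $\sigma(c^{-1})a\sigma(b^{-1})$, $\sigma(c^{-1})b\sigma(a^{-1})$, $\sigma(a^{-1})c\sigma(b^{-1})$, $\sigma(b^{-1})a\sigma(c^{-1})$. An admissible starting triple for $(R,P)$ is a triple $(a,b,c)\in\mathcal A^3$ such that $a,b,c$ are units in $R$ and all six noncommutative angles lie in $P$. *)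

(* Defs.v *)
From HB Require Import structures.
From mathcomp Require Import all_boot all_order all_algebra.
From mathcomp Require Import reals.
Set Implicit Arguments.
Unset Strict Implicit.
Unset Printing Implicit Defensive.
Import Order.TTheory GRing.Theory Num.Theory.
Local Open Scope ring_scope.

Section NoncommutativeAngles.
Variables (A : unitRingType) (sigma : A -> A).

Definition nc_angles (a b c : A) : seq A :=
  [:: sigma a^-1 * b * sigma c^-1;
      sigma b^-1 * c * sigma a^-1;
      sigma c^-1 * a * sigma b^-1;
      sigma c^-1 * b * sigma a^-1;
      sigma a^-1 * c * sigma b^-1;
      sigma b^-1 * a * sigma c^-1].

(* x is a unit of the subring S itself: its inverse must lie in S, not only
   in A. *)
Definition unit_in (S : {pred A}) (x : A) : Prop :=
  x \in S /\ exists2 y, y \in S & x * y = 1 /\ y * x = 1.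

Definition admissible_triple (S P : {pred A}) (a b c : A) : Prop :=
  [/\ unit_in S a, unit_in S b, unit_in S c
    & {subset nc_angles a b c <= P}].

End NoncommutativeAngles.

(* Dual x y stands for x + y * eps with eps ^+ 2 = 0. *)
Record dual (K : Type) : Type := Dual { dre : K; deps : K }.

Definition pair_of_dual K (x : dual K) : K * K := (dre x, deps x).
Definition dual_of_pair K (p : K * K) : dual K := Dual p.1 p.2.
Lemma pair_of_dualK K : cancel (@pair_of_dual K) (@dual_of_pair K).
Proof. by case. Qed.

HB.instance Definition _ (K : choiceType) :=
  Choice.copy (dual K) (can_type (@pair_of_dualK K)).

Section DualNumbers.
Variable K : comUnitRingType.
Implicit Types (x y z : dual K) (k : K).

Lemma dual_ext x y : dre x = dre y -> deps x = deps y -> x = y.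
Proof. by case: x y => [? ?] [? ?] /= -> ->. Qed.

Definition dual_zero : dual K := Dual 0 0.
Definition dual_opp x := Dual (- dre x) (- deps x).
Definition dual_add x y := Dual (dre x + dre y) (deps x + deps y).

Lemma dual_addA : associative dual_add.
Proof. by move=> x y z; apply: dual_ext; rewrite /= addrA. Qed.
Lemma dual_addC : commutative dual_add.
Proof. by move=> x y; apply: dual_ext; rewrite /= addrC. Qed.
Lemma dual_add0 : left_id dual_zero dual_add.
Proof. by move=> x; apply: dual_ext; rewrite /= add0r. Qed.
Lemma dual_addN : left_inverse dual_zero dual_opp dual_add.
Proof. by move=> x; apply: dual_ext; rewrite /= addNr. Qed.

HB.instance Definition _ :=
  GRing.isZmodule.Build (dual K) dual_addA dual_addC dual_add0 dual_addN.

Definition dual_one : dual K := Dual 1 0.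
Definition dual_mul x y :=
  Dual (dre x * dre y) (dre x * deps y + deps x * dre y).

Lemma dual_mulA : associative dual_mul.
Proof.
by move=> x y z; apply: dual_ext; rewrite /= ?mulrDl ?mulrDr !mulrA ?addrA.
Qed.
Lemma dual_mulC : commutative dual_mul.
Proof.
move=> x y; apply: dual_ext; rewrite /= ?[dre x * _]mulrC //.
by rewrite [deps x * _]mulrC addrC.
Qed.
Lemma dual_mul1 : left_id dual_one dual_mul.
Proof. by move=> x; apply: dual_ext; rewrite /= ?mul1r ?mul0r ?addr0. Qed.
Lemma dual_mulDl : left_distributive dual_mul dual_add.
Proof. by move=> x y z; apply: dual_ext; rewrite /= !mulrDl // addrACA. Qed.
Lemma dual_one_neq0 : dual_one != 0.
Proof. by apply/eqP => -[/eqP]; rewrite oner_eq0. Qed.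

HB.instance Definition _ :=
  GRing.Zmodule_isComNzRing.Build (dual K)
    dual_mulA dual_mulC dual_mul1 dual_mulDl dual_one_neq0.

Definition dual_unit : {pred dual K} := [pred x | dre x \is a GRing.unit].
Definition dual_inv x :=
  if x \in dual_unit then Dual (dre x)^-1 (- (deps x / dre x ^+ 2)) else x.

Lemma dual_mulV : {in dual_unit, left_inverse 1 dual_inv *%R}.
Proof.
move=> x Ux; rewrite /dual_inv Ux; move: Ux; rewrite inE => Ux.
apply: dual_ext; rewrite /= ?mulVr // mulNr -mulrA expr2 invrM //.
by rewrite -mulrA mulVr // mulr1 mulrC subrr.
Qed.
Lemma dual_unitPl x y : y * x = 1 -> dual_unit x.
Proof. by case=> yx _; apply/unitrPr; exists (dre y); rewrite mulrC. Qed.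
Lemma dual_inv_out : {in [predC dual_unit], dual_inv =1 id}.
Proof. by move=> x /negPf Ux; rewrite /dual_inv Ux. Qed.

HB.instance Definition _ :=
  GRing.ComNzRing_hasMulInverse.Build (dual K)
    dual_mulV dual_unitPl dual_inv_out.

Definition dual_scale k x := Dual (k * dre x) (k * deps x).

Lemma dual_scaleA k l x :
  dual_scale k (dual_scale l x) = dual_scale (k * l) x.
Proof. by apply: dual_ext; rewrite /= mulrA. Qed.
Lemma dual_scale1 : left_id 1 dual_scale.
Proof. by move=> x; apply: dual_ext; rewrite /= mul1r. Qed.
Lemma dual_scaleDr : right_distributive dual_scale +%R.
Proof. by move=> k x y; apply: dual_ext; rewrite /= mulrDr. Qed.
Lemma dual_scaleDl x : {morph dual_scale^~ x : k l / k + l}.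
Proof. by move=> k l; apply: dual_ext; rewrite /= mulrDl. Qed.

HB.instance Definition _ :=
  GRing.Zmodule_isLmodule.Build K (dual K)
    dual_scaleA dual_scale1 dual_scaleDr dual_scaleDl.

Lemma dual_scaleAl k x y : k *: (x * y) = (k *: x) * y.
Proof. by apply: dual_ext; rewrite /= ?mulrDr !mulrA. Qed.

HB.instance Definition _ :=
  GRing.Lmodule_isLalgebra.Build K (dual K) dual_scaleAl.
HB.instance Definition _ := GRing.Lalgebra_isComAlgebra.Build K (dual K).

Definition eps : dual K := Dual 0 1.

Lemma eps_sqr : eps ^+ 2 = 0.
Proof. by apply: dual_ext; rewrite /= ?mulr0 ?mul0r ?addr0. Qed.

Lemma dualE x : x = (dre x)%:A + deps x *: eps.
Proof. by apply: dual_ext; rewrite /= ?mulr1 ?mulr0 ?addr0 ?add0r. Qed.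

Definition dual_conj x : dual K := Dual (dre x) (- deps x).

Lemma dual_conjE k l : dual_conj (k%:A + l *: eps) = k%:A - l *: eps.
Proof.
by apply: dual_ext; rewrite /= ?mulr0 ?mulr1 ?oppr0 ?add0r ?subr0 ?addr0.
Qed.

Lemma dual_conjK : involutive dual_conj.
Proof. by move=> x; apply: dual_ext; rewrite /= ?opprK. Qed.

Lemma dual_conjM x y : dual_conj (x * y) = dual_conj y * dual_conj x.
Proof.
rewrite [RHS]mulrC; apply: dual_ext => //=.
by rewrite opprD mulrN mulNr.
Qed.

End DualNumbers.

Arguments eps {K}.

Section RealDualNumbers.
Variable R : realType.
Implicit Type x : dual R.

Definition dual_int : {pred dual R} :=
  [pred x | (dre x \is a Num.int) && (deps x \is a Num.int)].

Lemma dual_int_subring : subring_closed dual_int.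
Proof.
split=> [|x y|x y]; rewrite ?inE /=; first by rewrite rpred1 rpred0.
  by move=> /andP[? ?] /andP[? ?]; rewrite !rpredB.
by move=> /andP[? ?] /andP[? ?]; rewrite rpredM ?rpredD ?rpredM.
Qed.

(* The fixed points of dual_conj are the real numbers (dual_conj_fixed). *)
Definition dual_pos : {pred dual R} :=
  [pred x | (dual_conj x == x) && (0 < dre x)].

Lemma dual_conj_fixed x : dual_conj x = x <-> exists r : R, x = r%:A.
Proof.
split=> [/(congr1 (@deps R))/esym/eqP|[r ->]].
  rewrite -addr_eq0 -mulr2n mulrn_eq0 /= => /eqP x0.
  by exists (dre x); rewrite {1}[x]dualE x0 scale0r addr0.
by apply: dual_ext; rewrite //= mulr0 oppr0.
Qed.

Lemma dual_posP x : x \in dual_pos <-> exists2 r : R, 0 < r & x = r%:A.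
Proof.
rewrite inE /=; split=> [/andP[/eqP/dual_conj_fixed[r ->]]|[r r0 ->]].
  by rewrite /= mulr1 => r0; exists r.
by rewrite /= mulr1 r0 andbT; apply/eqP/dual_conj_fixed; exists r.
Qed.

End RealDualNumbers.

(* Main.v *)
Require Import Defs.
From mathcomp Require Import all_boot all_order all_algebra.
From mathcomp Require Import reals ring.
Import GRing.Theory.
Local Open Scope ring_scope.

(** The elements [1 + k eps] form a one-parameter group: since [eps ^+ 2 = 0],
    [k |-> 1 + k eps] turns addition into multiplication
    ([one_addZeps_mul]).  Conjugation and inversion both replace [k] by [- k],
    so their composite fixes each of these elements ([dual_conj_inv]), and an
    angle of the triple is just the product of its three entries in some
    order.  That product is [1 + (alpha + beta + gamma) eps = 1], a positive
    real.  The entries are units of the integral subring because the inverse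
    [1 - k eps] has integral coordinates as soon as [k] is an integer. *)

Section OneParameterGroup.
Variable K : comUnitRingType.
Implicit Types k l m : K.

Lemma one_addZepsE k : 1 + k *: eps = Dual 1 k.
Proof. by apply: dual_ext; rewrite /= ?mulr0 ?mulr1 ?addr0 ?add0r. Qed.

Lemma one_addZeps_mul k l :
  (1 + k *: eps) * (1 + l *: eps) = 1 + (k + l) *: eps.
Proof.
by rewrite !one_addZepsE; apply: dual_ext; rewrite /= !mul1r ?mulr1 // addrC.
Qed.

Lemma one_addZeps_mulN k : (1 + k *: eps) * (1 + - k *: eps) = 1.
Proof. by rewrite one_addZeps_mul subrr scale0r addr0. Qed.

(** Inversion and conjugation each send [k] to [- k], hence cancel out. *)
Lemma dual_conj_inv k : dual_conj (1 + k *: eps)^-1 = 1 + k *: eps.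
Proof.
rewrite (mulr1_eq (one_addZeps_mulN k)) !one_addZepsE.
by apply: dual_ext; rewrite //= opprK.
Qed.

Lemma nc_angle_one_addZeps k l m :
  dual_conj (1 + k *: eps)^-1 * (1 + l *: eps) * dual_conj (1 + m *: eps)^-1
    = 1 + (k + l + m) *: eps.
Proof. by rewrite !dual_conj_inv !one_addZeps_mul. Qed.

End OneParameterGroup.

Lemma one_addZeps_unit_in (R : realType) (k : int) :
  unit_in (@dual_int R) (1 + k%:~R *: eps).
Proof.
have intU (n : int) : 1 + n%:~R *: eps \in @dual_int R.
  by rewrite one_addZepsE inE /= rpred1 rpred_int.
split=> //; exists (1 + - k%:~R *: eps).
  by rewrite -mulrNz intU.
by split; last rewrite mulrC; apply: one_addZeps_mulN.
Qed.

Theorem proposition8p28 (R : realType) (alpha beta gamma : int)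
    (h : alpha + beta + gamma = 0) :
  admissible_triple (@dual_conj R) (@dual_int R) (@dual_pos R)
    (1 + alpha%:~R *: eps) (1 + beta%:~R *: eps) (1 + gamma%:~R *: eps).
Proof.
split; try exact: one_addZeps_unit_in.
have angle_pos (k l m : int) : k + l + m = 0 ->
    dual_conj (1 + k%:~R *: eps)^-1 * (1 + l%:~R *: eps) *
      dual_conj (1 + m%:~R *: eps)^-1 \in @dual_pos R.
  move=> klm0; apply/dual_posP; exists 1 => //.
  by rewrite nc_angle_one_addZeps -!intrD klm0 scale0r addr0 scale1r.
(* Each of the six angles uses every entry of the triple exactly once. *)
apply/allP; rewrite /= !angle_pos //; rewrite -[RHS]h; ring.
Qed.
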